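(* Let $(g,f)$ be a Riordan array over $\mathbb{R}$, with $g(0)=1$ and $f'(0)=\pm1$. Then $(g,f)$ is a pseudo-involution if and only if $(g,f)=X\hat{X}$, where $X$ is any Riordan array of the form $X=X_{(g,f)}\Psi$, where $$X_{(g,f)}=\left(\sqrt{g},\sqrt{zf}\right),\qquad \Psi=\left(\psi_1(z^2),\,z\psi_2(z^2)\right)$$ for arbitrary $\psi_1,\psi_2\in\mathcal{F}_0$.
   Context: $\mathcal{F}_k$ denotes the set of formal power series in $\mathbb{R}[[z]]$ of order exactly $k$ (lowest-degree nonzero term in degree $k$). A Riordan array is a pair $(g,f)\in\mathcal{F}_0\times\mathcal{F}_1$, identified with the infinite lower triangular matrix whose $k$-th column ($k\ge 0$) has generating function $gf^k$. Riordan arrays form a group under matrix multiplication: $(g,f)(G,F)=(g\cdot (G\circ f),\,F\circ f)$, with identity $(1,z)$ and inverse $(g,f)^{-1}=\left(\frac{1}{g\circ\overline{f}},\overline{f}\right)$, where $\overline{f}$ is the compositional inverse of $f$. A Riordan array $(g,f)$ is a pseudo-involution if $(g,-f)=(g,f)(1,-z)$ satisfies $(g,-f)^2=(1,z)$. The pseudo-inverse of a Riordan array $X$ is $\hat X=(1,-z)X^{-1}(1,-z)$. Here $\sqrt{g}$ and $\sqrt{zf}$ denote square roots of $g$ and of the product $z\cdot f(z)$, respectively.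
   Formalization: The square roots of g and zf are assumed to exist over the reals, so nothing is asserted when f'(0) = -1: there zf has no real square root, and the claim fails at the pseudo-involution (1,-z), since X times its pseudo-inverse always has f'(0) = 1. *)

(* Defs.v *)
From HB Require Import structures.
From mathcomp Require Import all_boot all_order all_algebra.
From mathcomp Require Import boolp functions.

Set Implicit Arguments.
Unset Strict Implicit.
Unset Printing Implicit Defensive.

Import Order.TTheory GRing.Theory Num.Theory.

Local Open Scope ring_scope.

(** Sequences defined by course-of-values recursion: [covrec F n] is [F]
    applied to the list of the [n] previous values. *)

Section CourseOfValues.
Variables (T : Type) (F : seq T -> T).

Fixpoint covprefix (n : nat) : seq T :=
  if n is m.+1 then let s := covprefix m in rcons s (F s) else [::].

Definition covrec (n : nat) : T := F (covprefix n).

Lemma covrecE n : covrec n = F (mkseq covrec n).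
Proof.
suff -> : mkseq covrec n = covprefix n by [].
by elim: n => // n IH; rewrite mkseqS IH.
Qed.

End CourseOfValues.

(** [f n] is the coefficient of z^n. *)

Definition fps (R : Type) : Type := nat -> R.

Notation "{ 'fps' R }" := (fps R) (at level 0, format "{ 'fps'  R }") : type_scope.

Section FpsRing.
Variable R : fieldType.
Implicit Types a b c f g : {fps R}.

HB.instance Definition _ := GRing.Zmodule.copy {fps R} (nat -> R).

Definition fps_one : {fps R} := fun n => (n == 0)%:R.

Definition fps_mul f g : {fps R} := fun n => \sum_(i < n.+1) f i * g (n - i)%N.

Fact fps_mulC : commutative fps_mul.
Proof.
move=> f g; apply/funext => n; rewrite /fps_mul.
rewrite (reindex_inj rev_ord_inj) /=; apply: eq_bigr => i _.
by rewrite subSS mulrC subKn // -ltnS.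
Qed.

Fact fps_mul1 : left_id fps_one fps_mul.
Proof.
move=> f; apply/funext => n; rewrite /fps_mul big_ord_recl /fps_one /= mul1r subn0.
by rewrite big1 ?addr0 // => i _; rewrite /= mul0r.
Qed.

Fact fps_mulDl : left_distributive fps_mul +%R.
Proof.
move=> f g h; apply/funext => n.
transitivity (\sum_(i < n.+1) (f i * h (n - i)%N + g i * h (n - i)%N)).
  by apply: eq_bigr => i _; rewrite -mulrDl.
by rewrite big_split.
Qed.

(* Summation over the triangle {(i, j) | i + j < N}, by diagonals. *)
Lemma sum_triangle (V : nmodType) N (F : nat -> nat -> V) :
  \sum_(k < N) \sum_(i < k.+1) F i (k - i)%N =
  \sum_(i < N) \sum_(j < N - i) F i j.
Proof.
elim: N => [|N IH]; first by rewrite !big_ord0.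
rewrite big_ord_recr IH /= [RHS](eq_bigr (fun i : 'I_N.+1 =>
  \sum_(j < N - i) F i j + F i (N - i)%N)); last first.
  by move=> i _; rewrite subSn ?big_ord_recr // -ltnS.
by rewrite big_split [X in _ = X + _]big_ord_recr /= subnn big_ord0 addr0.
Qed.

Fact fps_mulA : associative fps_mul.
Proof.
move=> f g h; apply/funext => n; rewrite /fps_mul.
under eq_bigr do rewrite big_distrr /=.
under [RHS]eq_bigr do rewrite big_distrl /=.
have := sum_triangle n.+1 (fun i j => f i * g j * h (n - (i + j))%N) => tri.
under [RHS]eq_bigr => k _.
  under eq_bigr => i _ do rewrite -[in h _](subnKC (ltn_ord i : i <= k)%N).
  over.
rewrite tri; apply: eq_bigr => i _; rewrite subSn -1?ltnS //.
by apply: eq_bigr => j _; rewrite mulrA subnDA.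
Qed.

Fact fps_oner_neq0 : fps_one != 0.
Proof.
by apply/eqP => /(congr1 (@^~ 0%N)) /eqP; rewrite /fps_one /= oner_eq0.
Qed.

HB.instance Definition _ := GRing.Zmodule_isComNzRing.Build {fps R}
  fps_mulA fps_mulC fps_mul1 fps_mulDl fps_oner_neq0.

Lemma fps_coef1 n : (1 : {fps R}) n = (n == 0)%:R. Proof. by []. Qed.

Lemma fps_coefM f g n : (f * g) n = \sum_(i < n.+1) f i * g (n - i)%N.
Proof. by []. Qed.

Lemma fps_coefD f g n : (f + g) n = f n + g n. Proof. by []. Qed.

Lemma fps_coefN f n : (- f) n = - f n. Proof. by []. Qed.

Lemma fps_coef_sum I (r : seq I) (P : pred I) (F : I -> {fps R}) n :
  (\sum_(i <- r | P i) F i) n = \sum_(i <- r | P i) F i n.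
Proof. by elim/big_rec2: _ => // i x y _ <-. Qed.

Lemma fps_coefM0 f g : (f * g) 0%N = f 0%N * g 0%N.
Proof. by rewrite fps_coefM big_ord1. Qed.

Definition fps_unit : {pred {fps R}} := fun f => f 0%N != 0.

Definition fps_inv f : {fps R} :=
  if f 0%N == 0 then f else
  covrec (fun s =>
    ((size s == 0)%:R - \sum_(i < size s) s`_i * f (size s - i)%N) / f 0%N).

Fact fps_mulV : {in fps_unit, left_inverse 1 fps_inv *%R}.
Proof.
move=> f f0; rewrite /fps_inv; have:= f0; rewrite unfold_in => /negPf ->.
set F := (X in covrec X); apply/funext => n; rewrite fps_coefM big_ord_recr /=.
rewrite covrecE {2}/F size_mkseq subnn divfK // addrC -[RHS]addr0 -addrA.
congr (_ + _); apply/eqP; rewrite addrC subr_eq0; apply/eqP.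
by apply: eq_bigr => i _; rewrite nth_mkseq.
Qed.

Fact fps_unitPl f g : g * f = 1 -> fps_unit f.
Proof.
move=> /(congr1 (@^~ 0%N)); rewrite fps_coefM0 fps_coef1 => gf1.
by apply/eqP => f0; move/eqP: gf1; rewrite f0 mulr0 eq_sym oner_eq0.
Qed.

Fact fps_inv_out : {in [predC fps_unit], fps_inv =1 id}.
Proof. by move=> f; rewrite !inE negbK /fps_inv => ->. Qed.

HB.instance Definition _ := GRing.ComNzRing_hasMulInverse.Build {fps R}
  fps_mulV fps_unitPl fps_inv_out.

Lemma fps_unitE f : (f \is a GRing.unit) = (f 0%N != 0). Proof. by []. Qed.

End FpsRing.

Section Composition.
Variable R : fieldType.
Implicit Types a b c f g h : {fps R}.

Definition fpsX : {fps R} := fun n => (n == 1)%:R.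

(** [f \in fps_order k] : the lowest-degree nonzero term of [f] is in degree
    exactly [k]. *)
Definition fps_order (k : nat) : {pred {fps R}} :=
  fun f => [forall i : 'I_k, f i == 0] && (f k != 0).

Lemma fps_order0 f : (f \in fps_order 0) = (f 0%N != 0).
Proof. by rewrite unfold_in; case: forallP => // -[] []. Qed.

Lemma fps_order1 f : (f \in fps_order 1) = (f 0%N == 0) && (f 1%N != 0).
Proof.
rewrite unfold_in; congr (_ && _); apply/forallP/idP => [/(_ ord0) //|f0 i].
by rewrite ord1.
Qed.

(** [fps_comp g f] is g(f(z)), i.e. [g \o f], meaningful when [f] has no
    constant term (the coefficient of z^n then only involves f^0, ..., f^n). *)
Definition fps_comp g f : {fps R} := fun n => \sum_(k < n.+1) g k * (f ^+ k) n.

Lemma coefX_lt f k n : f 0%N = 0 -> (n < k)%N -> (f ^+ k) n = 0.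
Proof.
move=> f0; elim: k n => // k IH n ltnk; rewrite exprS fps_coefM big_ord_recl /=.
rewrite f0 mul0r add0r big1 // => i _; rewrite /= IH ?mulr0 //.
by rewrite /bump /= add1n; case: n i ltnk => [[]//|n] i ltnk; rewrite subSS (leq_ltn_trans (leq_subr _ _)).
Qed.

Lemma coefX_diag f n : f 0%N = 0 -> (f ^+ n) n = f 1%N ^+ n.
Proof.
move=> f0; elim: n => // n IH; rewrite exprS fps_coefM big_ord_recl f0 mul0r add0r.
rewrite big_ord_recl /= subSS subn0 IH exprS big1 ?addr0 // => i _.
by rewrite [X in _ * X]coefX_lt ?mulr0 //= /bump /= !add1n subSS; rewrite ltn_subrL /= (leq_ltn_trans _ (ltn_ord i)).
Qed.

Lemma fps_compE g f N n : f 0%N = 0 -> (n < N)%N ->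
  fps_comp g f n = \sum_(k < N) g k * (f ^+ k) n.
Proof.
move=> f0 ltnN; rewrite /fps_comp [RHS](bigID (fun k : 'I_N => (k < n.+1)%N)) /=.
rewrite [X in _ = _ + X]big1 ?addr0 => [|k]; last first.
  by rewrite -leqNgt => ltnk; rewrite coefX_lt ?mulr0.
by rewrite (big_ord_widen N (fun k => g k * (f ^+ k) n)).
Qed.

Lemma fps_comp0 g f : fps_comp g f 0%N = g 0%N.
Proof. by rewrite /fps_comp big_ord1 expr0 fps_coef1 mulr1. Qed.

Lemma fps_comp1 g f : f 0%N = 0 -> fps_comp g f 1%N = g 1%N * f 1%N.
Proof.
by move=> f0; rewrite /fps_comp !big_ord_recl big_ord0 expr0 fps_coef1 mulr0 add0r addr0.
Qed.

Lemma fps_comp_one f : fps_comp 1 f = 1.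
Proof.
apply/funext => n; rewrite /fps_comp big_ord_recl expr0 fps_coef1 mul1r big1 ?addr0 // => i _.
by rewrite fps_coef1 mul0r.
Qed.

Lemma fps_compX f : f 0%N = 0 -> fps_comp fpsX f = f.
Proof.
move=> f0; apply/funext => n; rewrite (@fps_compE _ _ n.+2) // !big_ord_recl.
rewrite /fpsX /= mul0r add0r mul1r expr1 big1 ?addr0 // => i _.
by rewrite mul0r.
Qed.

Lemma coefXn k n : (fpsX ^+ k) n = (n == k)%:R.
Proof.
elim: k n => [|k IH] n; first by [].
rewrite exprS fps_coefM; case: n => [|n].
  by rewrite big_ord1 mul0r.
rewrite !big_ord_recl /= mul0r add0r mul1r subSS subn0 IH big1 ?addr0 // => i _.
by rewrite mul0r.
Qed.

Lemma fps_comp_X g : fps_comp g fpsX = g.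
Proof.
apply/funext => n; rewrite /fps_comp big_ord_recr /= coefXn eqxx mulr1 big1 ?add0r //.
by move=> i _; rewrite coefXn gtn_eqF ?mulr0.
Qed.

Lemma fps_compD g h f : fps_comp (g + h) f = fps_comp g f + fps_comp h f.
Proof.
apply/funext => n; rewrite /fps_comp fps_coefD -big_split /=.
by apply: eq_bigr => k _; rewrite fps_coefD mulrDl.
Qed.

Lemma fps_compN g f : fps_comp (- g) f = - fps_comp g f.
Proof.
apply/funext => n; rewrite /fps_comp fps_coefN -sumrN.
by apply: eq_bigr => k _; rewrite fps_coefN mulNr.
Qed.

Lemma fps_compM g h f : f 0%N = 0 ->
  fps_comp (g * h) f = fps_comp g f * fps_comp h f.
Proof.
move=> f0; apply/funext => n.
transitivity (\sum_(i < n.+1) \sum_(j < n.+1 - i) g i * h j * (f ^+ (i + j)) n).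
  rewrite -(sum_triangle _ (fun i j => g i * h j * (f ^+ (i + j)) n)).
  apply: eq_bigr => k _; rewrite fps_coefM big_distrl; apply: eq_bigr => i _ /=.
  by rewrite subnKC // -ltnS.
transitivity (\sum_(i < n.+1) \sum_(j < n.+1) g i * h j * (f ^+ (i + j)) n).
  apply: eq_bigr => i _.
  rewrite (big_ord_widen n.+1 (fun j => g i * h j * (f ^+ (i + j)) n)) ?leq_subr //.
  rewrite [RHS](bigID (fun j : 'I_n.+1 => (j < n.+1 - i)%N)) /=.
  rewrite [X in _ = _ + X]big1 ?addr0 // => j.
  by rewrite -leqNgt leq_subLR => lt; rewrite coefX_lt ?mulr0.
rewrite fps_coefM.
under [RHS]eq_bigr => m _.
  rewrite (@fps_compE _ _ n.+1) // (@fps_compE h _ n.+1) ?ltnS ?leq_subr //.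
  rewrite big_distrlr /=; over.
rewrite [RHS]exchange_big; apply: eq_bigr => i _ /=.
rewrite [RHS]exchange_big; apply: eq_bigr => j _ /=.
rewrite exprD fps_coefM big_distrr; apply: eq_bigr => m _ /=.
by rewrite mulrACA.
Qed.

Lemma fps_compXn g f k : f 0%N = 0 -> fps_comp (g ^+ k) f = fps_comp g f ^+ k.
Proof.
move=> f0; elim: k => [|k IH]; first by rewrite !expr0 fps_comp_one.
by rewrite !exprS fps_compM // IH.
Qed.

Lemma fps_compA h g f : g 0%N = 0 -> f 0%N = 0 ->
  fps_comp (fps_comp h g) f = fps_comp h (fps_comp g f).
Proof.
move=> g0 f0; have gf0 : fps_comp g f 0%N = 0 by rewrite fps_comp0.
apply/funext => n; rewrite (fps_compE _ f0 (ltnSn n)) (fps_compE _ gf0 (ltnSn n)).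
under eq_bigr => k _ do
  rewrite (fps_compE _ g0 (ltn_ord k)) big_distrl /=.
rewrite exchange_big; apply: eq_bigr => j _ /=.
rewrite -fps_compXn // (fps_compE _ f0 (ltnSn n)) big_distrr /=.
by apply: eq_bigr => k _; rewrite mulrA.
Qed.

(** The compositional inverse of [f \in fps_order 1], obtained by solving the
    triangular system [fps_comp h f = fpsX] for the coefficients of [h]. *)

Definition fps_compinv f : {fps R} :=
  covrec (fun s => ((size s == 1)%:R - \sum_(k < size s) s`_k * (f ^+ k) (size s))
                   / f 1%N ^+ size s).

Lemma fps_compinvL f : f \in fps_order 1 -> fps_comp (fps_compinv f) f = fpsX.
Proof.
rewrite fps_order1 => /andP[/eqP f0 f1].
rewrite /fps_compinv; set F := (X in covrec X); apply/funext => n.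
rewrite /fps_comp big_ord_recr /= coefX_diag // [in X in _ + X]covrecE {2}/F size_mkseq.
rewrite divfK ?expf_neq0 // addrC -[RHS]addr0 -addrA; congr (_ + _).
apply/eqP; rewrite addrC subr_eq0; apply/eqP.
by apply: eq_bigr => i _; rewrite nth_mkseq.
Qed.

Lemma fps_compinv_order f : f \in fps_order 1 -> fps_compinv f \in fps_order 1.
Proof.
move=> fO; have := fps_compinvL fO.
move: fO; rewrite !fps_order1 => /andP[/eqP f0 f1] E; apply/andP; split.
  by have := congr1 (@^~ 0%N) E; rewrite /= fps_comp0 => ->.
apply/eqP => h0; have := congr1 (@^~ 1%N) E; rewrite /= fps_comp1 // h0 mul0r.
by move/esym/eqP; rewrite oner_eq0.
Qed.

Lemma fps_order1_0 f : f \in fps_order 1 -> f 0%N = 0.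
Proof. by rewrite fps_order1 => /andP[/eqP]. Qed.

Lemma fps_compinvR f : f \in fps_order 1 -> fps_comp f (fps_compinv f) = fpsX.
Proof.
move=> fO; have hO := fps_compinv_order fO; have eO := fps_compinv_order hO.
have f0 := fps_order1_0 fO; have h0 := fps_order1_0 hO; have e0 := fps_order1_0 eO.
suff {1}-> : f = fps_compinv (fps_compinv f) by rewrite fps_compinvL.
rewrite -[LHS](fps_compX f0) -(fps_compinvL hO) fps_compA // fps_compinvL //.
by rewrite fps_comp_X.
Qed.

Lemma fps_comp_order0 g f : g \in fps_order 0 -> fps_comp g f \in fps_order 0.
Proof. by rewrite !fps_order0 fps_comp0. Qed.

Lemma fps_comp_order1 g f : g \in fps_order 1 -> f \in fps_order 1 ->
  fps_comp g f \in fps_order 1.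
Proof.
rewrite !fps_order1 fps_comp0 => /andP[-> g1] /andP[/eqP f0 f1].
by rewrite fps_comp1 // mulf_neq0.
Qed.

Lemma fps_mul_order0 g h : g \in fps_order 0 -> h \in fps_order 0 ->
  g * h \in fps_order 0.
Proof. by rewrite !fps_order0 fps_coefM0; apply: mulf_neq0. Qed.

Lemma fps_inv_order0 g : g \in fps_order 0 -> g^-1 \in fps_order 0.
Proof. by rewrite !fps_order0 -!fps_unitE unitrV. Qed.

Lemma fps_one_order : 1 \in fps_order 0.
Proof. by rewrite fps_order0 fps_coef1 oner_neq0. Qed.

Lemma fpsX_order : fpsX \in fps_order 1.
Proof. by rewrite fps_order1 /fpsX eqxx oner_neq0. Qed.

Lemma fps_opp_order k f : f \in fps_order k -> - f \in fps_order k.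
Proof.
case/andP => /forallP f0 fk; apply/andP; split; last by rewrite fps_coefN oppr_eq0.
by apply/forallP => i; rewrite fps_coefN oppr_eq0.
Qed.

End Composition.

Arguments fpsX {R}.

Definition riordan_pair (R : fieldType) : {pred {fps R} * {fps R}} :=
  fun p => (p.1 \in fps_order 0) && (p.2 \in fps_order 1).

Record riordan (R : fieldType) := RiordanPair {
  rpair :> {fps R} * {fps R};
  _ : rpair \in @riordan_pair R
}.

Definition Riordan (R : fieldType) (g f : {fps R})
    (gO : g \in fps_order 0) (fO : f \in fps_order 1) : riordan R :=
  @RiordanPair R (g, f) (introT andP (conj gO fO)).

Section RiordanGroup.
Variable R : fieldType.
Implicit Types A B C : riordan R.

HB.instance Definition _ := [isSub for @rpair R].
HB.instance Definition _ := [Choice of riordan R by <:].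

Lemma riordan_order0 A : A.1 \in fps_order 0.
Proof. by case: A => p /= /andP[]. Qed.

Lemma riordan_order1 A : A.2 \in fps_order 1.
Proof. by case: A => p /= /andP[]. Qed.

Lemma riordan0 A : A.2 0%N = 0.
Proof. exact: fps_order1_0 (riordan_order1 A). Qed.

Lemma riordanP A B : A.1 = B.1 -> A.2 = B.2 -> A = B.
Proof. by case: A B => -[g f] ? [[g' f'] ?] /= ? ?; apply/val_inj; congr (_, _). Qed.

Definition riordan_one : riordan R := Riordan (@fps_one_order R) (@fpsX_order R).

Definition riordan_mul A B : riordan R :=
  Riordan
    (fps_mul_order0 (riordan_order0 A) (fps_comp_order0 A.2 (riordan_order0 B)))
    (fps_comp_order1 (riordan_order1 B) (riordan_order1 A)).

Definition riordan_inv A : riordan R :=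
  Riordan
    (fps_inv_order0 (fps_comp_order0 (fps_compinv A.2) (riordan_order0 A)))
    (fps_compinv_order (riordan_order1 A)).

Fact riordan_mulA : associative riordan_mul.
Proof.
move=> A B C; apply: riordanP; rewrite /=.
  by rewrite fps_compM ?riordan0 // mulrA fps_compA ?riordan0.
by rewrite fps_compA ?riordan0.
Qed.

Fact riordan_mul1 : left_id riordan_one riordan_mul.
Proof. by move=> A; apply: riordanP; rewrite /= ?fps_comp_X ?mul1r. Qed.

Fact riordan_mulr1 : right_id riordan_one riordan_mul.
Proof.
by move=> A; apply: riordanP; rewrite /= ?fps_comp_one ?mulr1 ?fps_compX ?riordan0.
Qed.

Fact riordan_mulV : left_inverse riordan_one riordan_inv riordan_mul.
Proof.
move=> A; apply: riordanP; rewrite /=.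
  by rewrite mulVr // fps_unitE -fps_order0 fps_comp_order0 ?riordan_order0.
exact/fps_compinvR/riordan_order1.
Qed.

Fact riordan_mulrV : right_inverse riordan_one riordan_inv riordan_mul.
Proof.
move=> A; have e : riordan_mul A (riordan_inv A) =
    riordan_mul (riordan_inv (riordan_inv A)) (riordan_inv A).
  congr riordan_mul; rewrite -[LHS]riordan_mul1 -(riordan_mulV (riordan_inv A)).
  by rewrite -riordan_mulA riordan_mulV riordan_mulr1.
by rewrite e riordan_mulV.
Qed.

HB.instance Definition _ := isGroup.Build (riordan R)
  riordan_mulA riordan_mul1 riordan_mulr1 riordan_mulV riordan_mulrV.

(** The infinite matrix of a Riordan array: column k has generating function
    g f^k.  Group multiplication is multiplication of lower triangular
    matrices. *)

Definition riordan_mx A (n k : nat) : R := (A.1 * A.2 ^+ k) n.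

Lemma riordan_mx_trig A n k : (n < k)%N -> riordan_mx A n k = 0.
Proof.
move=> ltnk; rewrite /riordan_mx fps_coefM big1 // => i _.
by rewrite coefX_lt ?mulr0 ?riordan0 // (leq_ltn_trans (leq_subr _ _)).
Qed.

Lemma riordan_mxM A B n k :
  riordan_mx (A * B)%g n k = \sum_(j < n.+1) riordan_mx A n j * riordan_mx B j k.
Proof.
rewrite /riordan_mx /= -fps_compXn ?riordan0 // -mulrA -fps_compM ?riordan0 //.
set h := B.1 * _; rewrite fps_coefM.
under [LHS]eq_bigr => i _.
  rewrite (@fps_compE _ _ _ n.+1) ?riordan0 ?ltnS ?leq_subr // big_distrr /=; over.
rewrite exchange_big; apply: eq_bigr => j _ /=.
by rewrite fps_coefM big_distrl; apply: eq_bigr => i _ /=; rewrite mulrCA mulrC.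
Qed.

Lemma riordan_mx_inj A B : riordan_mx A =2 riordan_mx B -> A = B.
Proof.
move=> E; have E1 : A.1 = B.1.
  by apply/funext => n; have := E n 0%N; rewrite /riordan_mx !expr0 !mulr1.
apply: riordanP => //; have U : A.1 \is a GRing.unit by rewrite fps_unitE -fps_order0 riordan_order0.
apply: (mulrI U); rewrite [in RHS]E1; apply/funext => n.
by have := E n 1%N; rewrite /riordan_mx !expr1.
Qed.

Definition riordan_M : riordan R :=
  Riordan (@fps_one_order R) (fps_opp_order (@fpsX_order R)).

Lemma riordan_mulM A : (A * riordan_M)%g = (A.1, - A.2) :> {fps R} * {fps R}.
Proof. by rewrite /= fps_comp_one mulr1 fps_compN fps_compX ?riordan0. Qed.

Definition pseudo_involution A : Prop := ((A * riordan_M) ^+ 2 = 1)%g.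

Definition pseudo_inverse A : riordan R := (riordan_M * A^-1 * riordan_M)%g.

Lemma fps_checkO1 (psi1 : {fps R}) : psi1 \in fps_order 0 ->
  fps_comp psi1 (fpsX ^+ 2) \in fps_order 0.
Proof. exact: fps_comp_order0. Qed.

Lemma fps_checkO2 (psi2 : {fps R}) : psi2 \in fps_order 0 ->
  fpsX * fps_comp psi2 (fpsX ^+ 2) \in fps_order 1.
Proof.
rewrite fps_order0 fps_order1 fps_coefM0 mul0r eqxx fps_coefM !big_ord_recl big_ord0.
by rewrite /= mul0r add0r addr0 mul1r fps_comp0.
Qed.

Definition riordan_check (psi1 psi2 : {fps R})
    (psi1O : psi1 \in fps_order 0) (psi2O : psi2 \in fps_order 0) : riordan R :=
  Riordan (fps_checkO1 psi1O) (fps_checkO2 psi2O).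

End RiordanGroup.

(** z f has a square root of order 1 when f'(0) = 1, and no square root at all
    when f'(0) < 0: real arrays (sqrt g, sqrt (z f)) exist in the first case
    only. *)

Section SquareRoots.
Variable R : realFieldType.
Implicit Types f g h s : {fps R}.

Lemma fps_sqrt_ex g : g 0%N = 1 -> exists2 s : {fps R}, s 0%N = 1 & s ^+ 2 = g.
Proof.
move=> g0; pose F (l : seq R) : R := if l is [::] then 1 else
  (g (size l) - \sum_(i < (size l).-1) l`_i.+1 * l`_(size l - i.+1)) / 2%:R.
pose s : {fps R} := covrec F.
have s0 : s 0%N = 1 by [].
exists s => //; apply/funext => -[|m]; rewrite expr2 fps_coefM.
  by rewrite big_ord1 s0 mulr1.
rewrite big_ord_recr big_ord_recl /= subnn subn0 s0 mul1r mulr1.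
have -> : s m.+1 = (g m.+1 - \sum_(i < m) s i.+1 * s (m.+1 - i.+1)%N) / 2%:R.
  rewrite /s covrecE {1}/F /= size_map size_iota; congr ((_ - _) / _).
  apply: eq_bigr => i _; have := ltn_ord i => ltim.
  have nE k : (k < m.+1)%N -> (mkseq (covrec F) m.+1)`_k = covrec F k.
    by move=> ?; rewrite nth_mkseq.
  rewrite -[X in X * _ = _]/((mkseq (covrec F) m.+1)`_i.+1) !nE ?ltnS //.
  by rewrite subSS leq_subr.
set S := (X in (_ - X) / _).
have -> : \sum_(i < m) s (bump 0 i) * s (m.+1 - bump 0 i)%N = S by apply: eq_bigr.
by rewrite addrAC -splitr subrK.
Qed.

Lemma fps_coefXM g n : (fpsX * g) n.+1 = g n.
Proof.
rewrite fps_coefM !big_ord_recl /= mul0r add0r mul1r subSS subn0 big1 ?addr0 // => i _.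
by rewrite mul0r.
Qed.

Lemma fps_sqrtX_ex f : f \in fps_order 1 -> f 1%N = 1 ->
  exists2 s : {fps R}, s \in fps_order 1 & s ^+ 2 = fpsX * f.
Proof.
move=> fO f1; have [s s0 sE] := @fps_sqrt_ex (fun n => f n.+1) f1.
exists (fpsX * s).
  by rewrite fps_order1 fps_coefXM s0 fps_coefM0 mul0r eqxx oner_neq0.
rewrite exprMn sE expr2 -mulrA; congr (_ * _); apply/funext => -[|n].
  by rewrite fps_coefM0 mul0r (fps_order1_0 fO).
by rewrite fps_coefXM.
Qed.

Lemma fps_sqrtX_neg f s : f \in fps_order 1 -> (f 1%N < 0)%R ->
  s ^+ 2 <> fpsX * f.
Proof.
move=> fO f1 E; have s0 : s 0%N = 0.
  have := congr1 (@^~ 0%N) E; rewrite /= expr2 !fps_coefM0 mul0r => /eqP.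
  by rewrite mulf_eq0 orbb => /eqP.
have := congr1 (@^~ 2%N) E; rewrite /= fps_coefXM coefX_diag // => s1.
by move: f1; rewrite -s1 ltNge sqr_ge0.
Qed.

End SquareRoots.

(* Main.v *)
(** Write A = (g, f) and M = (1, -z), so that M^2 = 1.  Then A = X M X^-1 M iff
    A M X = X M, and since Psi commutes with M this condition does not change
    when X is replaced by Y = (sqrt g, sqrt (z f)).  If A M Y = Y M then A M is
    conjugate to M, hence an involution.  Conversely, put phi = - f; if
    (g, phi)^2 = 1, then (sqrt g * sqrt g(phi))^2 = g * g(phi) = 1 and, since
    phi(phi) = z, sqrt (z f)(phi)^2 = - phi * phi(phi) = z f.  Moreover
    f'(0) = 1, since z f is the square of a real series.  Comparing lowest
    coefficients therefore determines the signs: sqrt g * sqrt g(phi) = 1 and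
    sqrt (z f)(phi) = - sqrt (z f), that is, A M Y = Y M. *)

Require Import Defs.
From mathcomp Require Import all_boot all_order all_algebra reals.
From mathcomp Require Import boolp.
Set Implicit Arguments.
Unset Strict Implicit.
Unset Printing Implicit Defensive.
Import GRing.Theory.
Local Open Scope ring_scope.

Section PowerSeriesSquares.
Variable R : fieldType.
Implicit Types f h : {fps R}.

(** Strong induction on [n]: in coefficient [k + n] of [f * h], the terms with [i < k] vanish by the
    order of [f] and those with [i > k] by induction, which leaves [f k * h n = 0]. *)
Lemma fps_mulI_eq0 k f h : f \in fps_order k -> f * h = 0 -> h = 0.
Proof.
case/andP => /forallP f_lt fk fh0; apply/funext => n.
elim/ltn_ind: n => n IH; have := congr1 (@^~ (k + n)%N) fh0.
have ltk : (k < (k + n).+1)%N by rewrite ltnS leq_addr.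
rewrite /= fps_coefM (bigD1 (Ordinal ltk)) //= addKn big1 ?addr0 => [|i nik].
  by move/eqP; rewrite mulf_eq0 (negPf fk) => /eqP.
case: (ltngtP i k) => [ltik|gtik|eik].
- by have /eqP -> := f_lt (Ordinal ltik); rewrite mul0r.
- by rewrite IH ?mulr0 // ltn_subLR ?ltn_add2r // -ltnS.
- by case/eqP: nik; apply: val_inj.
Qed.

(** Fixes the sign of a square root: in [(f - h) * (f + h) = 0] the first factor has an order, so it
    can be cancelled. *)
Lemma fps_sqr_eq k f h : f - h \in fps_order k -> f ^+ 2 = h ^+ 2 -> f = - h.
Proof.
move=> fhO /eqP; rewrite -subr_eq0 subr_sqr => /eqP/(fps_mulI_eq0 fhO)/eqP.
by rewrite addr_eq0 => /eqP.
Qed.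

End PowerSeriesSquares.

Section PseudoInvolutions.
Variable R : fieldType.
Implicit Types (A X : riordan R) (p : {fps R}).

Lemma riordan_MM : (riordan_M R * riordan_M R = 1)%g.
Proof.
apply: riordanP; rewrite /= ?fps_comp_one ?mulr1 //.
by rewrite fps_compN fps_compX ?opprK // fps_coefN oppr0.
Qed.

Lemma eq_mul_pseudo_inverse A X :
  A = (X * pseudo_inverse X)%g <->
  (A * riordan_M R * X = X * riordan_M R)%g.
Proof.
rewrite /pseudo_inverse; split => [{1}->|E].
  by rewrite !mulgA -(mulgA _ (riordan_M R) (riordan_M R)) riordan_MM mulg1 mulgVK.
by rewrite !mulgA -E mulgK -mulgA riordan_MM mulg1.
Qed.

Lemma pseudo_involution_conj A X :
  (A * riordan_M R * X = X * riordan_M R)%g -> pseudo_involution A.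
Proof.
move=> E; rewrite /pseudo_involution; apply: (mulIg X).
by rewrite expgS expg1 -mulgA E mulgA E -mulgA riordan_MM mulg1 mul1g.
Qed.

Lemma pseudo_involutionP A : pseudo_involution A ->
  A.1 * fps_comp A.1 (- A.2) = 1 /\ fps_comp (- A.2) (- A.2) = fpsX.
Proof.
rewrite /pseudo_involution expgS expg1; set B := (A * _)%g => BB.
have [B1 B2] : B.1 = A.1 /\ B.2 = - A.2 by rewrite /B riordan_mulM.
by rewrite -B1 -B2; split; [have := congr1 (fun C : riordan R => C.1) BB
                           | have := congr1 (fun C : riordan R => C.2) BB].
Qed.

(** A series in z^2 is even; this is why Psi commutes with M. *)
Lemma fps_comp_sqrX_opp p :
  fps_comp (fps_comp p (fpsX ^+ 2)) (- fpsX) = fps_comp p (fpsX ^+ 2).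
Proof.
have X0 : (- fpsX : {fps R}) 0%N = 0 by rewrite fps_coefN oppr0.
rewrite fps_compA //; first by rewrite fps_compXn // fps_compX // sqrrN.
by rewrite coefX_lt.
Qed.

Lemma riordan_check_comm (psi1 psi2 : {fps R})
    (psi1O : psi1 \in fps_order 0) (psi2O : psi2 \in fps_order 0) :
  commute (riordan_check psi1O psi2O) (riordan_M R).
Proof.
have X0 : (- fpsX : {fps R}) 0%N = 0 by rewrite fps_coefN oppr0.
apply: riordanP; rewrite /=.
  by rewrite fps_comp_one mulr1 mul1r fps_comp_sqrX_opp.
rewrite fps_compM // fps_comp_sqrX_opp fps_compN !fps_compX ?mulNr //.
by rewrite fps_coefM0 mul0r.
Qed.

End PseudoInvolutions.

Lemma pseudo_involution_sqrt (R : realFieldType) (A Y : riordan R) :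
  A.1 0%N = 1 -> A.2 1%N = 1 -> Y.1 ^+ 2 = A.1 -> Y.2 ^+ 2 = fpsX * A.2 ->
  pseudo_involution A -> (A * riordan_M R * Y = Y * riordan_M R)%g.
Proof.
move=> g0 f1 sE tE /pseudo_involutionP [gg ff].
have phi0 : (- A.2) 0%N = 0 by rewrite fps_coefN riordan0 oppr0.
have two0 : (2%:R : R) != 0 by rewrite Num.Theory.pnatr_eq0.
have ss : Y.1 * fps_comp Y.1 (- A.2) = 1.
  (* Here [h] is -1, and the difference has constant term g(0) + 1 = 2. *)
  rewrite -[RHS]opprK; apply: (@fps_sqr_eq _ 0).
    rewrite fps_order0 opprK fps_coefD fps_coefM0 fps_comp0 -fps_coefM0.
    by rewrite -expr2 sE g0 fps_coef1 -mulr2n.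
  by rewrite exprMn -fps_compXn // sE gg sqrrN expr1n.
have tt : fps_comp Y.2 (- A.2) = - Y.2.
  (* The difference has no constant term, and its linear coefficient is -2 times that of [Y.2]. *)
  apply: (@fps_sqr_eq _ 1).
    have := riordan_order1 Y; rewrite !fps_order1 => /andP[/eqP t0 t1].
    rewrite !fps_coefD !fps_coefN fps_comp0 fps_comp1 // t0 subrr eqxx.
    by rewrite fps_coefN f1 mulrN1 -opprD oppr_eq0 -mulr2n -mulr_natr mulf_neq0.
  rewrite -fps_compXn // tE fps_compM // fps_compX //.
  by rewrite -[X in fps_comp X _]opprK fps_compN ff mulrNN mulrC.
have [B1 B2] : (A * riordan_M R)%g.1 = A.1 /\ (A * riordan_M R)%g.2 = - A.2.
  by rewrite riordan_mulM.
have [C1 C2] : (Y * riordan_M R)%g.1 = Y.1 /\ (Y * riordan_M R)%g.2 = - Y.2.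
  by rewrite riordan_mulM.
apply: riordanP.
  rewrite C1 -[LHS]/((A * riordan_M R)%g.1 * fps_comp Y.1 (A * riordan_M R)%g.2).
  by rewrite B1 B2 -sE expr2 -mulrA ss mulr1.
by rewrite C2 -[LHS]/(fps_comp Y.2 (A * riordan_M R)%g.2) B2.
Qed.

Theorem theorem2p9 (R : realType) (g f : {fps R})
    (gO : g \in fps_order 0) (fO : f \in fps_order 1)
    (g0 : g 0%N = 1) (f1 : f 1%N = 1 \/ f 1%N = -1)
    (sqrt_g sqrt_zf : {fps R})
    (sqrt_gO : sqrt_g \in fps_order 0) (sqrt_zfO : sqrt_zf \in fps_order 1)
    (sqrt_gE : sqrt_g ^+ 2 = g) (sqrt_zfE : sqrt_zf ^+ 2 = fpsX * f)
    (psi1 psi2 : {fps R})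
    (psi1O : psi1 \in fps_order 0) (psi2O : psi2 \in fps_order 0)
    (X : riordan R)
    (XE : X = (Riordan sqrt_gO sqrt_zfO * riordan_check psi1O psi2O)%g) :
  pseudo_involution (Riordan gO fO) <->
  Riordan gO fO = (X * pseudo_inverse X)%g.
Proof.
rewrite eq_mul_pseudo_inverse; split; last exact: pseudo_involution_conj.
case: f1 => [f1|fN1]; last first.
  (* The z^2 coefficient of [sqrt_zf ^+ 2] is a real square, so it cannot be -1. *)
  by case: (fps_sqrtX_neg fO _ sqrt_zfE); rewrite fN1 Num.Theory.ltrN10.
move=> /(@pseudo_involution_sqrt _ (Riordan gO fO) (Riordan sqrt_gO sqrt_zfO)
  g0 f1 sqrt_gE sqrt_zfE) E.
(* With Y = (sqrt g, sqrt (z f)), what remains is Y M Psi = Y Psi M. *)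
by rewrite XE mulgA E -!mulgA riordan_check_comm.
Qed.
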